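(* Let $L$ be a frame. Then $(\Phi_L,\eta,\mu)$ is a monad over the category $L\text{-}\mathbf{Top}_0$ of $T_0$ $L$-valued topological spaces and continuous mappings. That is, $\Phi_L$ is an endofunctor of $L\text{-}\mathbf{Top}_0$, $\eta:\mathrm{id}\to\Phi_L$ and $\mu:\Phi_L\circ\Phi_L\to\Phi_L$ are natural transformations, and for every $T_0$ $L$-valued topological space $X$ one has $\mu_X\circ\Phi_L(\mu_X)=\mu_X\circ\mu_{\Phi_L(X)}$ and $\mu_X\circ\eta_{\Phi_L(X)}=\mathrm{id}_{\Phi_L(X)}=\mu_X\circ\Phi_L(\eta_X)$.
   Context: $L$ is a fixed frame (complete Heyting algebra): a complete lattice with $a\wedge\bigvee S=\bigvee_{s\in S}(a\wedge s)$. An $L$-subset of a set $X$ is a map $X\to L$; $L^X$ carries the pointwise order and operations; $a_X$ is the constant map with value $a\in L$. For $f:X\to Y$ and $B\in L^Y$, $f_L^\leftarrow(B)=B\circ f$. An $L$-valued topology on $X$ is a family $\mathcal{O}(X)\subseteq L^X$ closed under binary meets and arbitrary joins and containing $a_X$ for every $a\in L$; $(X,\mathcal{O}(X))$ is then an $L$-valued topological space. It is $T_0$ if $A(x)=A(y)$ for all $A\in\mathcal{O}(X)$ implies $x=y$. A map $f:X\to Y$ is continuous if $f_L^\leftarrow(B)\in\mathcal{O}(X)$ for every $B\in\mathcal{O}(Y)$. An open filter of $X$ is a map $u:\mathcal{O}(X)\to L$ with $u(A\wedge B)=u(A)\wedge u(B)$ for all $A,B\in\mathcal{O}(X)$ and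 $u(a_X)\ge a$ for all $a\in L$. $\Phi_L(X)$ is the set of open filters of $X$. For $A\in\mathcal{O}(X)$ let $\phi(A):\Phi_L(X)\to L$, $\phi(A)(u)=u(A)$. $\Phi_L(X)$ carries the $L$-valued topology $\mathcal{O}(\Phi_L(X))$ with base $\{\phi(A)\mid A\in\mathcal{O}(X)\}$, i.e. consisting of all joins $\bigvee_j\phi(A_j)\wedge(a_j)_{\Phi_L(X)}$ with $A_j\in\mathcal{O}(X)$, $a_j\in L$. For continuous $f:X\to Y$, $\Phi_L f:\Phi_L(X)\to\Phi_L(Y)$ is $(\Phi_L f)(u)(B)=u(f_L^\leftarrow(B))$ for $B\in\mathcal{O}(Y)$. $\eta_X:X\to\Phi_L(X)$ is $\eta_X(x)=[x]$, where $[x](B)=B(x)$ for $B\in\mathcal{O}(X)$. $\mu_X:\Phi_L(\Phi_L(X))\to\Phi_L(X)$ is $\mu_X(\alpha)(A)=\alpha(\phi(A))$ for $A\in\mathcal{O}(X)$. *)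

(* Defs.v *)
From HB Require Import structures.
From mathcomp Require Import all_boot all_order.
From mathcomp Require Import boolp classical_sets.

Set Implicit Arguments.
Unset Strict Implicit.
Unset Printing Implicit Defensive.

Import Order.TTheory.

Local Open Scope classical_set_scope.
Local Open Scope order_scope.

#[local] Obligation Tactic := idtac.

Reserved Notation "a ⊓ b" (at level 48, left associativity).
Reserved Notation "f ∘ g" (at level 50, left associativity).

HB.mixin Record TBLattice_isFrame d (L : Type) of Order.TBLattice d L := {
  bigjoin : set L -> L;
  bigjoinP : forall S : set L, supremums S (bigjoin S);
  meet_bigjoin : forall (a : L) (S : set L),
    Order.meet a (bigjoin S) = bigjoin [set Order.meet a s | s in S]
}.

#[short(type="frameType")]
HB.structure Definition Frame d := {L of TBLattice_isFrame d L & Order.TBLattice d L}.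

(* The meet notation of order.v clashes with intersection of classical sets. *)
Notation "a ⊓ b" := (Order.meet a b) : order_scope.

Section FrameTheory.
Context {d : Order.disp_t} {L : frameType d}.
Implicit Types (a b : L) (S : set L).

Lemma bigjoin_ub S a : S a -> a <= bigjoin S.
Proof. by move=> Sa; case: (bigjoinP S) => + _; apply. Qed.

Lemma bigjoin_le S b : (forall a, S a -> a <= b) -> bigjoin S <= b.
Proof. by move=> Sb; case: (bigjoinP S) => _; apply. Qed.

Lemma bigjoin1 a : bigjoin [set a] = a.
Proof.
by apply/le_anti; rewrite bigjoin_ub // bigjoin_le // => _ ->.
Qed.

Lemma bigjoin_meet S T :
  bigjoin S ⊓ bigjoin T = bigjoin [set p.1 ⊓ p.2 | p in S `*` T].
Proof.
apply/le_anti/andP; split.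
  rewrite meetC meet_bigjoin; apply: bigjoin_le => _ [s Ss <-].
  rewrite meetC meet_bigjoin; apply: bigjoin_le => _ [t Tt <-].
  by apply: bigjoin_ub; exists (s, t).
apply: bigjoin_le => _ [[s t] [/= Ss Tt] <-].
by apply: leI2; exact: bigjoin_ub.
Qed.

End FrameTheory.

Section LTopology.
Context {d : Order.disp_t} {L : frameType d}.

Definition is_Ltopology (X : Type) (O : set (X -> L)) : Prop :=
  [/\ forall A B, O A -> O B -> O (fun x => A x ⊓ B x),
      forall F : set (X -> L), F `<=` O -> O (fun x => bigjoin [set A x | A in F]) &
      forall a : L, O (fun=> a)].

End LTopology.

Record Ltop (d : Order.disp_t) (L : frameType d) := MkLtop {
  carrier :> Type;
  Lopen : set (carrier -> L);
  LopenP : is_Ltopology Lopen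
}.

Section LSpaces.
Context {d : Order.disp_t} {L : frameType d}.

Definition Lcontinuous (X Y : Ltop L) (f : X -> Y) : Prop :=
  forall B : Y -> L, Lopen B -> Lopen (B \o f).

Definition LT0 (X : Ltop L) : Prop :=
  forall x y : X, (forall A : X -> L, Lopen A -> A x = A y) -> x = y.

(* O(X) as a type *)
Record opens (X : Ltop L) := MkOpens {
  oval :> X -> L;
  ovalP : Lopen oval
}.

Lemma opens_eq (X : Ltop L) (A B : opens X) : (forall x, A x = B x) -> A = B.
Proof.
case: A B => [A oA] [B oB] /= /funext AB; move: oA; rewrite AB => oA.
by congr MkOpens; exact: Prop_irrelevance.
Qed.

Definition opensI (X : Ltop L) (A B : opens X) : opens X :=
  MkOpens (let: And3 H _ _ := LopenP X in H _ _ (ovalP A) (ovalP B)).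

Definition opens_cst (X : Ltop L) (a : L) : opens X :=
  MkOpens (let: And3 _ _ H := LopenP X in H a).

Definition opens_preim (X Y : Ltop L) (f : X -> Y) (cf : Lcontinuous f)
  (B : opens Y) : opens X := MkOpens (cf _ (ovalP B)).

End LSpaces.

Record open_filter (d : Order.disp_t) (L : frameType d) (X : Ltop L) :=
    MkOpenFilter {
  fval :> opens X -> L;
  fvalI : forall A B : opens X, fval (opensI A B) = fval A ⊓ fval B;
  fval_cst : forall a : L, a <= fval (opens_cst X a)
}.

Section Phi.
Context {d : Order.disp_t} {L : frameType d}.

Lemma open_filter_eq (X : Ltop L) (u v : open_filter X) :
  (forall A, u A = v A) -> u = v.
Proof.
case: u v => [u uI uc] [v vI vc] /= /funext uv; move: uI uc; rewrite uv => uI uc.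
by congr MkOpenFilter; exact: Prop_irrelevance.
Qed.

Lemma open_filter_le (X : Ltop L) (u : open_filter X) (A B : opens X) :
  (forall x, A x <= B x) -> u A <= u B.
Proof.
move=> AB; have <- : opensI A B = A.
  by apply: opens_eq => x /=; apply/meet_idPl.
by rewrite fvalI leIr.
Qed.

Definition phi (X : Ltop L) (A : opens X) : open_filter X -> L := fun u => u A.

(* A family (A_j, a_j)_j is given by its set of values; this loses nothing, as
   joins are idempotent. *)
Definition Phi_Lopen (X : Ltop L) : set (open_filter X -> L) :=
  [set W | exists S : set (opens X * L),
     W = fun u => bigjoin [set phi p.1 u ⊓ p.2 | p in S]].

Lemma Phi_topology (X : Ltop L) : is_Ltopology (@Phi_Lopen X).
Proof.
split.
- move=> _ _ [S ->] [T ->].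
  exists [set (opensI p.1.1 p.2.1, p.1.2 ⊓ p.2.2) | p in S `*` T].
  apply/funext => u; rewrite bigjoin_meet; congr bigjoin.
  apply/seteqP; split => [_ [[_ _] [/= [p Sp <-] [q Tq <-]] <-]|].
    exists (opensI p.1 q.1, p.2 ⊓ q.2); first by exists (p, q).
    by rewrite /phi /= fvalI meetACA.
  move=> _ [_ [[p q] [/= Sp Tq] <-] <-] /=.
  exists (phi p.1 u ⊓ p.2, phi q.1 u ⊓ q.2); first by split; [exists p|exists q].
  by rewrite /phi /= fvalI meetACA.
- move=> F FO.
  exists [set p | exists2 W, F W & forall u, phi p.1 u ⊓ p.2 <= W u].
  apply/funext => u; apply/le_anti/andP; split; apply: bigjoin_le.
    move=> _ [W FW <-]; have [S WE] := FO _ FW.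
    rewrite {1}WE; apply: bigjoin_le => _ [p Sp <-].
    apply: bigjoin_ub; exists p => //; exists W => // v.
    by rewrite WE; apply: bigjoin_ub; exists p.
  move=> _ [p [W FW pW] <-]; apply: le_trans (pW u) _.
  by apply: bigjoin_ub; exists W.
- move=> a; exists [set (opens_cst X \top, a)]; apply/funext => u.
  rewrite image_set1 bigjoin1 /phi /=.
  have -> : u (opens_cst X \top) = \top.
    by apply/le_anti; rewrite lex1 fval_cst.
  by rewrite meet1x.
Qed.

Definition Phi (X : Ltop L) : Ltop L := MkLtop (@Phi_topology X).

Lemma phi_Lopen (X : Ltop L) (A : opens X) : Lopen (phi A : Phi X -> L).
Proof.
exists [set (A, \top)]; apply/funext => u.
by rewrite image_set1 bigjoin1 meetx1.
Qed.

Definition phi_open (X : Ltop L) (A : opens X) : opens (Phi X) :=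
  MkOpens (phi_Lopen A).

Program Definition Phi_map (X Y : Ltop L) (f : X -> Y) (cf : Lcontinuous f) :
    Phi X -> Phi Y :=
  fun u => @MkOpenFilter _ _ Y (fun B => fval u (opens_preim cf B)) _ _.
Next Obligation.
by move=> X Y f cf u A B; rewrite -fvalI; congr (fval u _); exact: opens_eq.
Qed.
Next Obligation.
move=> X Y f cf u a; apply: le_trans (fval_cst u a) _.
exact: open_filter_le.
Qed.

Program Definition Phi_eta (X : Ltop L) : X -> Phi X :=
  fun x => @MkOpenFilter _ _ X (fun B => B x) _ _.
Next Obligation. by []. Qed.
Next Obligation. by move=> X x a /=. Qed.

Program Definition Phi_mu (X : Ltop L) : Phi (Phi X) -> Phi X :=
  fun alpha => @MkOpenFilter _ _ X (fun A => fval alpha (phi_open A)) _ _.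
Next Obligation.
move=> X alpha A B; rewrite -fvalI; congr (fval alpha _).
by apply: opens_eq => u /=; rewrite /phi fvalI.
Qed.
Next Obligation.
move=> X alpha a; apply: le_trans (fval_cst alpha a) _.
by apply: open_filter_le => u /=; exact: fval_cst.
Qed.

End Phi.

Record category := MkCategory {
  Ob :> Type;
  Hom : Ob -> Ob -> Type;
  idm : forall X, Hom X X;
  compm : forall X Y Z, Hom Y Z -> Hom X Y -> Hom X Z;
  comp1m : forall X Y (f : Hom X Y), compm (idm Y) f = f;
  compm1 : forall X Y (f : Hom X Y), compm f (idm X) = f;
  compmA : forall X Y Z T (h : Hom Z T) (g : Hom Y Z) (f : Hom X Y),
    compm h (compm g f) = compm (compm h g) f
}.

Declare Scope cat_scope.
Notation "f ∘ g" := (compm f g) : cat_scope.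
Arguments idm {c} X.

Section Monads.
Local Open Scope cat_scope.

Definition is_functor (C D : category) (F0 : C -> D)
    (F1 : forall X Y : C, Hom X Y -> Hom (F0 X) (F0 Y)) : Prop :=
  (forall X : C, F1 X X (idm X) = idm (F0 X)) /\
  (forall (X Y Z : C) (g : Hom Y Z) (f : Hom X Y),
     F1 X Z (g ∘ f) = F1 Y Z g ∘ F1 X Y f).

Definition is_natural (C D : category) (F0 G0 : C -> D)
    (F1 : forall X Y : C, Hom X Y -> Hom (F0 X) (F0 Y))
    (G1 : forall X Y : C, Hom X Y -> Hom (G0 X) (G0 Y))
    (n : forall X : C, Hom (F0 X) (G0 X)) : Prop :=
  forall (X Y : C) (f : Hom X Y), n Y ∘ F1 X Y f = G1 X Y f ∘ n X.

Definition is_monad (C : category) (T0 : C -> C)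
    (T1 : forall X Y : C, Hom X Y -> Hom (T0 X) (T0 Y))
    (unit : forall X : C, Hom X (T0 X))
    (mult : forall X : C, Hom (T0 (T0 X)) (T0 X)) : Prop :=
  [/\ is_functor T1,
      @is_natural C C (fun X => X) T0 (fun X Y f => f) T1 unit,
      @is_natural C C (fun X => T0 (T0 X)) T0
        (fun X Y f => T1 (T0 X) (T0 Y) (T1 X Y f)) T1 mult,
      forall X : C, mult X ∘ T1 _ _ (mult X) = mult X ∘ mult (T0 X) &
      forall X : C, mult X ∘ unit (T0 X) = idm (T0 X) /\
                    mult X ∘ T1 _ _ (unit X) = idm (T0 X)].

End Monads.

Section LTop0.
Context {d : Order.disp_t} (L : frameType d).

Record Ltop0 := MkLtop0 {
  Lspace :> Ltop L;
  Lspace_T0 : LT0 Lspace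
}.

Record Lmap (X Y : Ltop L) := MkLmap {
  lmap :> X -> Y;
  lmap_cont : Lcontinuous lmap
}.

Lemma Lmap_eq (X Y : Ltop L) (f g : Lmap X Y) : (forall x, f x = g x) -> f = g.
Proof.
case: f g => [f cf] [g cg] /= /funext fg; move: cf; rewrite fg => cf.
by congr MkLmap; exact: Prop_irrelevance.
Qed.

Lemma Lcontinuous_id (X : Ltop L) : Lcontinuous (@id X).
Proof. by []. Qed.

Lemma Lcontinuous_comp (X Y Z : Ltop L) (g : Lmap Y Z) (f : Lmap X Y) :
  Lcontinuous (g \o f).
Proof. by move=> B oB; exact: lmap_cont f _ (lmap_cont g oB). Qed.

Program Definition LTop0 : category := @MkCategory Ltop0 (fun X Y => Lmap X Y)
  (fun X => MkLmap (@Lcontinuous_id X))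
  (fun X Y Z g f => MkLmap (Lcontinuous_comp g f)) _ _ _.
Next Obligation. by move=> X Y f; exact: Lmap_eq. Qed.
Next Obligation. by move=> X Y f; exact: Lmap_eq. Qed.
Next Obligation. by move=> X Y Z T h g f; exact: Lmap_eq. Qed.

End LTop0.

(* Main.v *)
Require Import Defs.
From mathcomp Require Import all_boot all_order.
From mathcomp Require Import boolp classical_sets.

(** Each structure map pulls a basic open set back to an open set:
    [phi B \o Phi_map f = phi (B \o f)], [phi A \o Phi_eta = A] and
    [phi A \o Phi_mu = phi (phi A)].  As the sets [phi A] form a base, this gives
    continuity; evaluated at open filters, the same identities give naturality
    and the monad laws. *)

(** Joins and meets are pointwise, so precomposition with [f] preserves them and leaves constants
    fixed. *)
Lemma Lcontinuous_to_Phi {d : Order.disp_t} {L : frameType d} {X Y : Ltop L}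
    (f : Y -> Phi X) :
  (forall A : opens X, Lopen (fun y => phi A (f y))) -> Lcontinuous f.
Proof.
move=> fA _ [S ->]; have [OI OJ Oc] := LopenP Y.
pose F := ([set (fun y => Order.meet (phi p.1 (f y)) p.2) | p in S])%classic.
have -> : (fun u => bigjoin ([set Order.meet (phi p.1 u) p.2 | p in S])%classic)
    \o f = (fun y => bigjoin ([set A y | A in F])%classic).
  by apply/funext => y /=; rewrite /F image_comp.
(* Each member of [F] is the meet of an open set with a constant. *)
by apply: OJ => _ [p _ <-]; apply: OI; [exact: fA | exact: Oc].
Qed.

(** Since [phi A u] is [u A], the basic open sets already separate open filters. *)
Lemma Phi_LT0 {d : Order.disp_t} {L : frameType d} (X : Ltop L) : LT0 (Phi X).
Proof.
by move=> u v uv; apply: open_filter_eq => A; exact: uv (phi_Lopen A).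
Qed.

Lemma Phi_map_Lcontinuous {d : Order.disp_t} {L : frameType d} {X Y : Ltop L}
    {f : X -> Y} (cf : Lcontinuous f) : Lcontinuous (Phi_map cf).
Proof.
by apply: Lcontinuous_to_Phi => B; exact: (phi_Lopen (opens_preim cf B)).
Qed.

Lemma Phi_eta_Lcontinuous {d : Order.disp_t} {L : frameType d} (X : Ltop L) :
  Lcontinuous (@Phi_eta d L X).
Proof. by apply: Lcontinuous_to_Phi => A; exact: ovalP. Qed.

Lemma Phi_mu_Lcontinuous {d : Order.disp_t} {L : frameType d} (X : Ltop L) :
  Lcontinuous (@Phi_mu d L X).
Proof. by apply: Lcontinuous_to_Phi => A; exact: (phi_Lopen (phi_open A)). Qed.

Theorem theorem3p7 (d : Order.disp_t) (L : frameType d) :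
  exists (Phi_T0 : forall X : LTop0 L, LT0 (Phi X))
         (Phi_map_cont : forall (X Y : LTop0 L) (f : Hom X Y),
            Lcontinuous (Phi_map (lmap_cont f)))
         (eta_cont : forall X : LTop0 L, Lcontinuous (@Phi_eta d L X))
         (mu_cont : forall X : LTop0 L, Lcontinuous (@Phi_mu d L X)),
    @is_monad (LTop0 L)
      (fun X => MkLtop0 (Phi_T0 X))
      (fun X Y f => MkLmap (Phi_map_cont X Y f))
      (fun X => MkLmap (eta_cont X))
      (fun X => MkLmap (mu_cont X)).
Proof.
exists (fun X : Ltop0 L => Phi_LT0 X),
  (fun (X Y : Ltop0 L) (f : Lmap X Y) => Phi_map_Lcontinuous (lmap_cont f)),
  (fun X : Ltop0 L => Phi_eta_Lcontinuous X),
  (fun X : Ltop0 L => Phi_mu_Lcontinuous X).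
split; [split => [X|X Y Z g f] | move=> X Y f | move=> X Y f | move=> X
  | move=> X; split]; apply: Lmap_eq => u; apply: open_filter_eq => A //=;
  (* The laws left after computation compare values of one open filter [u] at two open sets that
     agree pointwise but carry different openness proofs. *)
  by congr (fval u _); exact: opens_eq.
Qed.
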